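(* Let $f:[0,\infty)\to[0,\infty)$ be ultrametric-metric-preserving. Then the following statements are equivalent: (i) $f$ is continuous at $0$; (ii) $f$ is weakly continuous at $0$; (iii) for every $\varepsilon>0$, there exists an $x>0$ such that $f(x)<\varepsilon$; (iv) $f$ is quasi continuous at $0$; (v) $f$ is a.c.S. at $0$; (vi) $f$ is a.c.H. at $0$.
   Context: An ultrametric space is a metric space $(X,d)$ satisfying $d(x,y)\leq \max\{d(x,z),d(z,y)\}$ for all $x,y,z\in X$. A function $f:[0,\infty)\to[0,\infty)$ is ultrametric-metric-preserving if for all ultrametric spaces $(X,d)$, $f\circ d$ is a metric on $X$. The set $[0,\infty)$ carries its usual topology. $f$ is weakly continuous at $0$ if there is a strictly decreasing sequence $(y_n)$ in $[0,\infty)$ converging to $0$ such that $f(y_n)$ converges to $f(0)$. For topological spaces $X,Y$ and $g:X\to Y$: $g$ is quasi continuous at $a\in X$ if for all open sets $U$ of $X$ and $V$ of $Y$ with $a\in U$ and $g(a)\in V$, there is a nonempty open set $G$ of $X$ such that $G\subseteq U$ and $g(G)\subseteq V$. $g$ is a.c.S. at $x$ (almost continuous in the sense of Singal) if for each open set $V$ of $Y$ containing $g(x)$ there exists an open set $U$ containing $x$ such that $g(U)\subseteq \operatorname{Int}(\overline V)$. $g$ is a.c.H. at $x$ (almost continuous in the sense of Husain) if for each open set $V$ of $Y$ containing $g(x)$, $\overline{g^{-1}(V)}$ is a neighborhood of $x$. *)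

(* Defs.v *)
From mathcomp Require Import all_boot all_order all_algebra.
From mathcomp Require Import all_classical all_reals all_analysis.

Set Implicit Arguments.
Unset Strict Implicit.
Unset Printing Implicit Defensive.

Import Order.TTheory GRing.Theory Num.Theory.
Import numFieldNormedType.Exports.

Local Open Scope classical_set_scope.
Local Open Scope ring_scope.

(* [0, oo) as a type; the library equips [set_type A] with the topology
   induced by the inclusion of A, i.e. the usual topology of [0, oo).  A
   notation, not a definition, so that canonical structures are found. *)
Notation nnreal R := (set_type [set x : R | 0 <= x]).

Definition nnreal0 (R : realType) : nnreal R :=
  exist _ 0 (mem_set (lexx 0)).

Section Metrics.
Variables (R : realType) (X : Type).
Implicit Type d : X -> X -> nnreal R.

Definition is_metric d : Prop :=
  [/\ forall x y, set_val (d x y) = 0 <-> x = y,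
      forall x y, d x y = d y x &
      forall x y z, set_val (d x y) <= set_val (d x z) + set_val (d z y)].

Definition is_ultrametric d : Prop :=
  is_metric d /\
  forall x y z,
    set_val (d x y) <= Num.max (set_val (d x z)) (set_val (d z y)).

End Metrics.

Definition ultrametric_metric_preserving (R : realType)
    (f : nnreal R -> nnreal R) : Prop :=
  forall (X : Type) (d : X -> X -> nnreal R),
    is_ultrametric d -> is_metric (fun x y => f (d x y)).

(* [decreasing_seq] is strict: u m <= u n iff n <= m. *)
Definition weakly_continuous_at0 (R : realType)
    (f : nnreal R -> nnreal R) : Prop :=
  exists y : nat -> nnreal R,
    [/\ decreasing_seq (fun n => set_val (y n)),
        y n @[n --> \oo] --> nnreal0 R &
        f (y n) @[n --> \oo] --> f (nnreal0 R)].

Section GeneralizedContinuity.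
Variables (X Y : topologicalType) (g : X -> Y).

Definition quasi_continuous_at (a : X) : Prop :=
  forall (U : set X) (V : set Y), open U -> open V -> U a -> V (g a) ->
    exists G : set X, [/\ open G, G !=set0, G `<=` U & g @` G `<=` V].

Definition acS_at (x : X) : Prop :=
  forall V : set Y, open V -> V (g x) ->
    exists U : set X, [/\ open U, U x & g @` U `<=` (closure V)°].

Definition acH_at (x : X) : Prop :=
  forall V : set Y, open V -> V (g x) -> nbhs x (closure (g @^-1` V)).

End GeneralizedContinuity.

(* Main.v *)
(* Applying f to an isosceles triangle with legs b and base a <= b gives
   f a <= 2 (f b), so one small value of f at a positive point makes f small on
   a whole neighborhood of 0.  Thus arbitrarily small values at positive points
   already force continuity at 0, and each of the weak continuity notions
   produces such values because every nonempty open subset of [0, oo) contains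
   a positive point. *)
Require Import Defs.
From mathcomp Require Import all_boot all_order all_algebra.
From mathcomp Require Import all_classical all_reals all_analysis.
From mathcomp Require Import lra.
Import Order.TTheory GRing.Theory Num.Theory.
Import numFieldNormedType.Exports.
Local Open Scope classical_set_scope.
Local Open Scope ring_scope.

Lemma nnreal_ge0 (R : realType) (x : nnreal R) : 0 <= set_val x.
Proof. exact: (set_valP x). Qed.

Lemma nnreal_inj (R : realType) (x y : nnreal R) :
  set_val x = set_val y -> x = y.
Proof. exact: val_inj. Qed.

Lemma nbhs_nnrealP (R : realType) (a : nnreal R) (A : set (nnreal R)) :
  nbhs a A <-> exists2 e : R, 0 < e &
    forall x : nnreal R, `|set_val a - set_val x| < e -> A x.
Proof.
split=> [/nbhs_ballP[e /= e0 H]|[e e0 H]]; first by exists e.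
by apply/nbhs_ballP; exists e.
Qed.

Lemma nbhs_nnreal0P (R : realType) (A : set (nnreal R)) :
  nbhs (nnreal0 R) A <-> exists2 e : R, 0 < e &
    forall x : nnreal R, set_val x < e -> A x.
Proof.
rewrite nbhs_nnrealP; split=> -[e e0 H]; exists e => // x xe; apply: H.
  by rewrite sub0r normrN ger0_norm// nnreal_ge0.
by move: xe; rewrite sub0r normrN ger0_norm// nnreal_ge0.
Qed.

Lemma open_nnreal_lt (R : realType) (e : R) :
  open [set x : nnreal R | set_val x < e].
Proof.
rewrite openE => x /= xe; apply/nbhs_nnrealP; exists (e - set_val x).
  by rewrite subr_gt0.
by move=> y /=; rewrite ltr_norml => /andP[]; lra.
Qed.

(** Needed for a.c.S., which controls [f] only up to the closure of a neighborhood. *)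
Lemma closure_nnreal_lt (R : realType) (e : R) :
  closure [set x : nnreal R | set_val x < e] `<=`
    [set x : nnreal R | set_val x <= e].
Proof.
move=> x xcl /=; rewrite leNgt; apply/negP => ex.
have /xcl [y [/= ye]] : nbhs x [set y : nnreal R | e < set_val y].
  apply/nbhs_nnrealP; exists (set_val x - e); first by rewrite subr_gt0.
  by move=> y /=; rewrite ltr_norml => /andP[]; lra.
by rewrite ltNge (ltW ye).
Qed.

Lemma nbhs_nnreal_gt0 (R : realType) (a : nnreal R) (A : set (nnreal R)) :
  nbhs a A -> exists2 x : nnreal R, 0 < set_val x & A x.
Proof.
move=> /nbhs_nnrealP[e e0 H]; have a0 := nnreal_ge0 _ a.
(* Moving right from [a] by half the radius stays in the half-line and gives a positive point even
   when [a] is 0. *)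
have p0 : 0 < set_val a + e / 2 by lra.
exists (exist _ (set_val a + e / 2) (mem_set (ltW p0))) => //.
by apply: H; rewrite /= opprD addNKr normrN gtr0_norm; lra.
Qed.

Lemma ump_f0 (R : realType) (f : nnreal R -> nnreal R) :
  ultrametric_metric_preserving f -> f (nnreal0 R) = nnreal0 R.
Proof.
move=> hf; have [H _ _] : is_metric (fun _ _ : unit => f (nnreal0 R)).
  (* On a one-point space the only distance is 0, and its image must again be the distance of a
     point to itself. *)
  apply: (hf unit (fun _ _ => nnreal0 R)); split; last first.
    by move=> *; rewrite le_max lexx.
  by split=> [[] []||] // *; rewrite addr0.
exact/nnreal_inj/(H tt tt).
Qed.

Lemma ump_quasi_monotone (R : realType) (f : nnreal R -> nnreal R)
    (a b : nnreal R) :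
  ultrametric_metric_preserving f ->
  set_val a <= set_val b -> set_val (f a) <= 2 * set_val (f b).
Proof.
(* The case [a = 0] is separate: a base of length 0 would put two distinct points at distance 0. *)
move=> hf ab; have [a0|a0] := eqVneq (set_val a) 0.
  have -> : a = nnreal0 R by exact: nnreal_inj.
  by rewrite (ump_f0 _ _ hf) mulr_ge0// nnreal_ge0.
have {}a0 : 0 < set_val a by rewrite lt0r a0 nnreal_ge0.
have b0 : 0 < set_val b by exact: lt_le_trans ab.
(* An isosceles triangle with apex [None], legs [b] and base [a]. *)
pose d (x y : option bool) : nnreal R :=
  if x == y then nnreal0 R else if (x == None) || (y == None) then b else a.
have dE x : d x x = nnreal0 R by rewrite /d eqxx.
have du : is_ultrametric d.
  (* The strong inequality comes first; the triangle inequality follows because a maximum of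
     nonnegative numbers is at most their sum. *)
  have m x y z :
      set_val (d x y) <= Num.max (set_val (d x z)) (set_val (d z y)).
    rewrite le_max.
    by move: x y z => [[]|] [[]|] [[]|] //=; rewrite /d/= ?lexx ?ab ?orbT//
      ?(ltW a0) ?(ltW b0) ?nnreal_ge0 ?orbT.
  split=> //; split=> [x y|x y|x y z].
  - split=> [|->]; last by rewrite dE.
    by rewrite /d; case: eqP => // _; case: ifP => _ /eqP; rewrite gt_eqF.
  - by rewrite /d eq_sym orbC.
  - apply: le_trans (m x y z) _.
    by rewrite ge_max lerDl lerDr !nnreal_ge0.
(* Going from one end of the base to the other through the apex bounds [f a] by [f b + f b]. *)
have [_ _ /(_ (Some true) (Some false) None)] := hf _ _ du.
by rewrite /d/= mulr2n mulrDl mul1r.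
Qed.

(** Condition (iii), the hub to which each weak form of continuity is reduced. *)
Definition arbitrarily_small_values (R : realType) (f : nnreal R -> nnreal R) :=
  forall e : R, 0 < e ->
    exists x : nnreal R, 0 < set_val x /\ set_val (f x) < e.

Lemma ump_continuous0 (R : realType) (f : nnreal R -> nnreal R) :
  ultrametric_metric_preserving f -> arbitrarily_small_values R f ->
  {for nnreal0 R, continuous f}.
Proof.
move=> hf sv A; rewrite (ump_f0 _ _ hf) => /nbhs_nnreal0P[e e0 eA].
have e20 : 0 < e / 2 by lra.
have [x [x0 fx]] := sv _ e20.
(* The point [x] itself serves as radius: below it [f] is at most [2 * f x], hence less than [e]. *)
apply/nbhs_nnreal0P; exists (set_val x) => // y /ltW.
by move=> /(ump_quasi_monotone _ _ _ _ hf) yx; apply: eA; lra.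
Qed.

Lemma continuous0_weakly (R : realType) (f : nnreal R -> nnreal R) :
  {for nnreal0 R, continuous f} -> weakly_continuous_at0 f.
Proof.
move=> fc.
have y_ge0 n : 0 <= n.+1%:R^-1 :> R by rewrite invr_ge0.
pose y n : nnreal R := exist _ (n.+1%:R^-1) (mem_set (y_ge0 n)).
have ycvg : y n @[n --> \oo] --> nnreal0 R.
  move=> A /nbhs_nnreal0P[e e0 eA].
  near=> n; apply: eA => /=.
  by near: n; exact: near_infty_natSinv_lt (PosNum e0).
exists y; split=> //; last exact: continuous_cvg.
move=> m n; change ((n.+1%:R^-1 <= m.+1%:R^-1 :> R) = (m <= n)%N).
by rewrite lef_pV2 ?posrE ?ltr0n// ler_nat ltnS.
Unshelve. all: by end_near. Qed.

Lemma weakly_continuous0_small (R : realType) (f : nnreal R -> nnreal R) :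
  f (nnreal0 R) = nnreal0 R -> weakly_continuous_at0 f ->
  arbitrarily_small_values R f.
Proof.
move=> f0 [y [ydec _ fy]] e e0.
have /fy [n _ /(_ n (leqnn n)) /= fyn] :
    nbhs (f (nnreal0 R)) [set x : nnreal R | set_val x < e].
  by rewrite f0; apply/nbhs_nnreal0P; exists e.
exists (y n); split => //.
(* Strict decrease makes [y n] positive, as it exceeds the nonnegative [y n.+1]. *)
apply: le_lt_trans (nnreal_ge0 _ (y n.+1)) _.
by rewrite ltNge ydec ltnn.
Qed.

Lemma quasi_continuous0_small (R : realType) (f : nnreal R -> nnreal R) :
  f (nnreal0 R) = nnreal0 R -> quasi_continuous_at f (nnreal0 R) ->
  arbitrarily_small_values R f.
Proof.
move=> f0 fq e e0.
have [||G [Go [a Ga] _ Ge]] := fq _ _ openT (open_nnreal_lt R e); rewrite ?f0//.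
have [x x0 Gx] := nbhs_nnreal_gt0 _ _ _ (open_nbhs_nbhs (conj Go Ga)).
by exists x; split=> //; apply: Ge; exists x.
Qed.

Lemma acS0_small (R : realType) (f : nnreal R -> nnreal R) :
  f (nnreal0 R) = nnreal0 R -> acS_at f (nnreal0 R) ->
  arbitrarily_small_values R f.
Proof.
move=> f0 fS e e0.
(* Halving restores strictness: the closure of [[0, e/2)] only yields [f x <= e / 2]. *)
have e20 : 0 < e / 2 by lra.
have [|U [Uo U0 fU]] := fS _ (open_nnreal_lt R (e / 2)); first by rewrite f0.
have [x x0 Ux] := nbhs_nnreal_gt0 _ _ _ (open_nbhs_nbhs (conj Uo U0)).
have /interior_subset /closure_nnreal_lt /= fx := fU _ (imageP f Ux).
by exists x; split=> //; lra.
Qed.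

Lemma acH0_small (R : realType) (f : nnreal R -> nnreal R) :
  f (nnreal0 R) = nnreal0 R -> acH_at f (nnreal0 R) ->
  arbitrarily_small_values R f.
Proof.
move=> f0 fH e e0.
have [|x x0 xcl] := nbhs_nnreal_gt0 _ _ _ (fH _ (open_nnreal_lt R e) _).
  by rewrite /= f0.
(* The point [x] lies only in the closure of the preimage, so [f x] may be large; the positive
   half-line is a neighborhood of [x] and therefore meets the preimage itself. *)
have /xcl[z [/= fz z0]] : nbhs x [set z : nnreal R | 0 < set_val z].
  apply/nbhs_nnrealP; exists (set_val x) => // z /=.
  by rewrite ltr_norml => /andP[]; lra.
by exists z.
Qed.

Lemma continuous_quasi (X Y : topologicalType) (g : X -> Y) (a : X) :
  {for a, continuous g} -> quasi_continuous_at g a.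
Proof.
move=> gc U V Uo Vo Ua Vga.
have n : nbhs a (U `&` g @^-1` V).
  by apply: filterI; [exact: open_nbhs_nbhs|apply: gc; exact: open_nbhs_nbhs].
(* Continuity at the single point [a] does not make the preimage open, so its interior is taken. *)
exists (U `&` g @^-1` V)°; split.
- exact: open_interior.
- by exists a.
- by move=> x /interior_subset[].
- by move=> _ [x /interior_subset[_ ?] <-].
Qed.

Lemma continuous_acS (X Y : topologicalType) (g : X -> Y) (a : X) :
  {for a, continuous g} -> acS_at g a.
Proof.
move=> gc V Vo Vga; exists (g @^-1` V)°; split.
- exact: open_interior.
- by apply: gc; exact: open_nbhs_nbhs.
- move=> _ [x /interior_subset /= Vx <-].
  by apply: filterS (@subset_closure _ V) _; exact: open_nbhs_nbhs.
Qed.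

Lemma continuous_acH (X Y : topologicalType) (g : X -> Y) (a : X) :
  {for a, continuous g} -> acH_at g a.
Proof.
move=> gc V Vo Vga; apply: filterS (@subset_closure _ _) _.
by apply: gc; exact: open_nbhs_nbhs.
Qed.

Theorem theorem26 (R : realType) (f : nnreal R -> nnreal R)
    (hf : ultrametric_metric_preserving f) :
  [<-> {for nnreal0 R, continuous f};
       weakly_continuous_at0 f;
       forall e : R, 0 < e ->
         exists x : nnreal R, 0 < set_val x /\ set_val (f x) < e;
       quasi_continuous_at f (nnreal0 R);
       acS_at f (nnreal0 R);
       acH_at f (nnreal0 R)].
Proof.
have f0 := ump_f0 _ _ hf; have fc := ump_continuous0 _ _ hf.
tfae.
- exact: continuous0_weakly.
- exact: weakly_continuous0_small.
(* From here on each implication of the cycle passes through continuity at 0, regained from small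
   values by [fc]. *)
- by move=> /fc; exact: continuous_quasi.
- by move=> /(quasi_continuous0_small _ _ f0)/fc; exact: continuous_acS.
- by move=> /(acS0_small _ _ f0)/fc; exact: continuous_acH.
- by move=> /(acH0_small _ _ f0)/fc.
Qed.
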